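(* Let $G$ be a bipartite graph with bipartition $V_1=\{x_1,\ldots,x_g\}$, $V_2=\{y_1,\ldots,y_g\}$ and with a perfect matching $e_1,\ldots,e_g$ such that $e_i=\{x_i,y_i\}$ for all $i$. Then $\Gamma=\Delta_G^{[g]}$ is pure shellable if and only if we can order $e_1,\ldots,e_g$ (that is, simultaneously relabel the $x_i$ and $y_i$ by one permutation of $\{1,\ldots,g\}$) such that $\{x_i,y_j\}\in E(G)$ implies $i\leq j$.
   Context: Graphs are finite and simple. $\Delta_G$ is the simplicial complex on the vertex set of $G$ whose faces are the independent (stable) sets of vertices of $G$, i.e. sets containing no edge of $G$. For $0\leq k\leq\dim(\Delta_G)+1$, the $k$th pure skeleton of $\Delta_G$ is $\Delta_G^{[k]}=\langle\{F\in\Delta_G : |F|=k\}\rangle$, the subcomplex of $\Delta_G$ generated by the faces with exactly $k$ elements. A simplicial complex $\Delta$ is shellable if its facets can be ordered $F_1,\ldots,F_s$ such that for all $1\leq i<j\leq s$ there exist $v\in F_j\setminus F_i$ and $\ell\in\{1,\ldots,j-1\}$ with $F_j\setminus F_\ell=\{v\}$. It is pure if all its facets have the same dimension, and pure shellable if it is both pure and shellable. *)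

(* Defs.v *)
From mathcomp Require Import all_boot all_fingroup.

Set Implicit Arguments.
Unset Strict Implicit.
Unset Printing Implicit Defensive.

Local Open Scope nat_scope.

(** A finite simple graph on [T] is a relation [e : rel T] that is assumed
    symmetric and irreflexive wherever it is used. *)
Section Graphs.
Variables (T : finType) (e : rel T).

Definition edges : {set {set T}} :=
  [set A | [exists u, exists v, e u v && (A == [set u; v])]].

Definition stable (S : {set T}) : bool :=
  [forall A in edges, ~~ (A \subset S)].

Definition bipartition (V1 V2 : {set T}) : Prop :=
  [/\ V1 :|: V2 = [set: T], [disjoint V1 & V2], stable V1 & stable V2].

Definition perfect_matching (M : {set {set T}}) : Prop :=
  M \subset edges /\ partition M [set: T].

End Graphs.

Section Complexes.
Variable T : finType.
Implicit Types (D S : {set {set T}}) (F H : {set T}).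

(** Complexes are represented by their set of faces; a point of [T] need not
    itself be a face, so that subcomplexes stay over the same [T]. *)
Definition simplicial_complex D : Prop :=
  forall F H, F \in D -> H \subset F -> H \in D.

Definition generated_complex S : {set {set T}} :=
  [set H : {set T} | [exists F in S, H \subset F]].

Definition pure_skeleton D (k : nat) : {set {set T}} :=
  generated_complex [set F in D | #|F| == k].

Definition facets D : {set {set T}} := [set F : {set T} | maxset (mem D) F].

(** [dim F = #|F| - 1], so equal dimension is equal cardinality. *)
Definition pure D : Prop :=
  forall F H, F \in facets D -> H \in facets D -> #|F| = #|H|.

(** The facets are numbered from 0; [set0] is only the default of [nth]. *)
Definition shelling D (s : seq {set T}) : Prop :=
  [/\ uniq s,
      s =i facets D
    & forall i j, i < j < size s ->
        exists v l, [/\ v \in nth set0 s j :\: nth set0 s i,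
                        l < j
                      & nth set0 s j :\: nth set0 s l = [set v]]].

Definition shellable D : Prop := exists s, shelling D s.

Definition pure_shellable D : Prop := pure D /\ shellable D.

Lemma generated_complexP S : simplicial_complex (generated_complex S).
Proof.
move=> F H; rewrite !inE => /exists_inP[K KS FK] HF.
by apply/exists_inP; exists K => //; apply: subset_trans FK.
Qed.

End Complexes.

Definition independence_complex (T : finType) (e : rel T) : {set {set T}} :=
  [set S | stable e S].

Lemma independence_complexP (T : finType) (e : rel T) :
  simplicial_complex (independence_complex e).
Proof.
move=> F H; rewrite !inE => /forall_inP stF HF; apply/forall_inP => A Ae.
by apply: contra (stF A Ae) => AH; apply: subset_trans HF.
Qed.

(* Main.v *)
Require Import Defs.
From mathcomp Require Import all_boot all_fingroup.

(** Write i -> j when x_i and y_j are adjacent. A stable set with g elements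
    takes exactly one endpoint of each matching edge, so it is determined by the
    indices i of its points x_i, and stability says that this set of indices is
    closed under ->. These sets are the facets of the skeleton
    ([facets_pure_skeleton]), which makes it pure; two of them F and H satisfy
    #|F :\: H| = 1 exactly when their index sets differ in a single index.

    If i -> j implies i <= j, list the facets by increasing number of points
    x_i. When H precedes F, some x_k lies in F but not in H, and for the least
    such k replacing x_k by y_k in F gives again a stable set
    ([exchange_stable]), which has one point x_i fewer and hence precedes F.

    Conversely, let the skeleton be shellable. Any two-valued function that is
    not constant on the facets changes between two facets that differ in one
    vertex ([shelling_crossing]). The function telling whether x_i is in F is
    not constant, as all the x_i form a facet and so do all the y_i; hence two
    distinct indices cannot be in the index sets of the same facets, because
    both would then change at once ([facets_separate]). So if i -> j and
    i <> j, the facets through x_i form a proper subset of those through x_j,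
    and sorting the indices by the number of facets through x_i gives the
    required order. *)

Set Implicit Arguments.
Unset Strict Implicit.
Unset Printing Implicit Defensive.

(** * Skeletons and shellings of arbitrary complexes *)

Lemma facets_pure_skeleton (T : finType) (D : {set {set T}}) k :
  facets (pure_skeleton D k) = [set F in D | #|F| == k].
Proof.
apply/setP => F; rewrite !inE; apply/idP/idP.
  case/maxsetP; rewrite /= inE => /exists_inP[K KDk FK] maxF.
  rewrite -(maxF K) => [| |//]; first by move: KDk; rewrite inE.
  by rewrite inE; apply/exists_inP; exists K.
move=> /andP[FD /eqP cF]; apply/maxsetP; split.
  by rewrite /= inE; apply/exists_inP; exists F; rewrite // inE FD cF eqxx.
move=> H; rewrite /= inE => /exists_inP[K].
rewrite inE => /andP[_ /eqP cK] HK FH.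
apply/eqP; rewrite eq_sym eqEcard FH cF -cK.
exact: subset_leq_card.
Qed.

(** A shelling starts on one side of [b]; the first facet on the other side
    has, by the shelling condition, a neighbour among the earlier ones. *)
Lemma shelling_crossing (T : finType) (D : {set {set T}}) s
    (b : {set T} -> bool) F1 F2 :
  shelling D s -> F1 \in facets D -> F2 \in facets D -> b F1 != b F2 ->
  exists F H v, [/\ F \in facets D, H \in facets D,
                    F :\: H = [set v] & b F != b H].
Proof.
move=> [_ sE shell] F1D F2D b12.
pose c F := b F != b (nth set0 s 0).
have hc : has c s.
  apply/hasP; case: (boolP (c F1)) => [cF1|ncF1].
    by exists F1; rewrite ?sE.
  exists F2; rewrite ?sE // /c.
  by move: b12 ncF1; rewrite /c; do 3 case: (b _).
have j_lt : find c s < size s by rewrite -has_find.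
have cj : c (nth set0 s (find c s)) by apply: nth_find.
have j_gt0 : 0 < find c s.
  by case: (find c s) cj => //; rewrite /c eqxx.
have [|v [l [_ lj Dl]]] := shell 0 (find c s); first by rewrite j_gt0.
exists (nth set0 s (find c s)), (nth set0 s l), v; split => //.
- by rewrite -sE mem_nth.
- by rewrite -sE mem_nth // (ltn_trans lj).
- by have /negbFE/eqP-> := before_find set0 lj.
Qed.

Lemma sorting_perm n (f : 'I_n -> nat) :
  exists s : {perm 'I_n}, forall i j : 'I_n, i < j -> f (s i) <= f (s j).
Proof.
pose r := relpre f leq; pose t := [tuple of sort r (ord_tuple n)].
have inj_t : injective (tnth t).
  by apply/tuple_uniqP; rewrite sort_uniq val_ord_tuple enum_uniq.
exists (perm inj_t) => i j ij; rewrite !permE !(tnth_nth i).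
have r_tr : transitive r by move=> a b c; apply: leq_trans.
have r_tot : total r by move=> a b; apply: leq_total.
apply: (sorted_ltn_nth r_tr i (sort_sorted r_tot (ord_tuple n))) => //;
  by rewrite inE size_tuple.
Qed.

(** * Stable sets of a bipartite graph with a perfect matching *)

Section Matching.

Variables (T : finType) (e : rel T) (g : nat) (x y : 'I_g -> T).
Hypotheses (inj_x : injective x) (inj_y : injective y).

Let X := [set x i | i : 'I_g].
Let Y := [set y i | i : 'I_g].

Hypothesis bip : bipartition e X Y.
Hypothesis xy_edge : forall i, [set x i; y i] \in edges e.

Let facet (F : {set T}) := stable e F && (#|F| == g).

Lemma vertexP u : (exists i, u = x i) \/ (exists i, u = y i).
Proof.
case: bip => XY _ _ _; have : u \in X :|: Y by rewrite XY inE.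
by case/setUP => /imsetP[i _ ->]; [left | right]; exists i.
Qed.

Lemma x_in_X i : x i \in X.
Proof. exact: imset_f. Qed.

Lemma x_neq_y i j : x i != y j.
Proof.
case: bip => _ dXY _ _; have := disjointFr dXY (x_in_X i).
by apply: contraFneq => ->; apply: imset_f.
Qed.

Lemma stable_edge (F : {set T}) i j :
  stable e F -> [set x i; y j] \in edges e -> x i \in F -> y j \notin F.
Proof.
move=> /forall_inP stF /stF eF xF; apply: contra eF => yF.
by rewrite subUset !sub1set xF.
Qed.

(** Both sides of the bipartition are stable, so every edge joins them. *)
Lemma edges_stable (F : {set T}) :
  (forall i j, [set x i; y j] \in edges e -> x i \in F -> y j \notin F) ->
  stable e F.
Proof.
move=> noF; case: bip => _ _ /forall_inP stX /forall_inP stY.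
apply/forall_inP => A Ae; apply/negP => AF.
have := Ae; rewrite inE => /existsP[u /existsP[v /andP[_ /eqP defA]]].
move: AF (stX A Ae) (stY A Ae); rewrite defA !subUset !sub1set.
move: Ae; rewrite defA => {A defA}.
have [[i ->]|[i ->]] := vertexP u; have [[j ->]|[j ->]] := vertexP v.
- by rewrite !imset_f.
- by move=> eA /andP[xF yF]; have := noF i j eA xF; rewrite yF.
- rewrite setUC => eA /andP[yF xF].
  by have := noF j i eA xF; rewrite yF.
- by rewrite !imset_f.
Qed.

(** The g matching edges cover the vertices and a stable set contains at most
    one endpoint of each, so a stable set of size g contains exactly one. *)
Lemma facet_y (F : {set T}) i : facet F -> (y i \in F) = (x i \notin F).
Proof.
move=> /andP[stF /eqP cF].
pose A := [set i | x i \in F]; pose B := [set i | y i \in F].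
have F_sub : F \subset (x @: A) :|: (y @: B).
  apply/subsetP => u; have [[j ->]|[j ->]] := vertexP u => uF.
    by rewrite inE imset_f // inE.
  by rewrite inE orbC imset_f // inE.
have dAB : [disjoint A & B].
  rewrite disjoint_subset; apply/subsetP => j; rewrite !inE.
  exact: stable_edge.
have AB : A :|: B = setT.
  apply/eqP; rewrite eqEcard subsetT cardsT card_ord.
  rewrite -[X in X <= _]cF; apply: leq_trans (subset_leq_card F_sub) _.
  apply: leq_trans (leq_card_setU _ _) _.
  rewrite !card_imset //.
  by rewrite cardsU (disjoint_setI0 dAB) cards0 subn0.
have := in_setT i; rewrite -AB !inE.
have := @stable_edge F i i stF (xy_edge i).
by case: (x i \in F) => [/(_ isT)/negPf->|].
Qed.

Lemma facet_inj (F H : {set T}) :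
  facet F -> facet H -> (forall i, (x i \in F) = (x i \in H)) -> F = H.
Proof.
move=> fF fH FH; apply/setP => u; have [[i ->]|[i ->]] := vertexP u => //.
by rewrite !facet_y // FH.
Qed.

Lemma facet_X : facet X.
Proof.
case: bip => _ _ stX _.
by rewrite /facet stX card_imset // card_ord eqxx.
Qed.

Lemma facet_Y : facet Y.
Proof.
case: bip => _ _ _ stY.
by rewrite /facet stY card_imset // card_ord eqxx.
Qed.

Lemma x_notin_Y i : x i \notin Y.
Proof. by rewrite -(facet_y i facet_Y) imset_f. Qed.

Lemma facetsE : facets (pure_skeleton (independence_complex e) g) =i facet.
Proof. by move=> F; rewrite facets_pure_skeleton !inE. Qed.

(** Only edges at the new vertex y_k could spoil stability. In terms of index
    sets: removing k keeps the index set of F closed under -> when no other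
    index i in it satisfies i -> k. *)
Lemma exchange_stable (F : {set T}) k :
  facet F -> x k \in F ->
  (forall i, x i \in F -> [set x i; y k] \in edges e -> i = k) ->
  facet (y k |: (F :\ x k)).
Proof.
move=> fF xkF kmin; have /andP[stF /eqP cF] := fF; apply/andP; split.
  apply: edges_stable => i j eij; rewrite !inE (negPf (x_neq_y i k)) /=.
  move=> /andP[ik xiF]; rewrite (negPf (stable_edge stF eij xiF)) andbF orbF.
  apply: contra ik => /eqP/inj_y jk; apply/eqP; congr x.
  by apply: kmin; rewrite // -jk.
rewrite cardsU1 !inE facet_y // xkF andbF /=.
by rewrite -cF (cardsD1 (x k) F) xkF.
Qed.

(** * Shellings and orderings of the matching *)

(** If x_i and x_j are in the same facets, then two facets that differ on i
    differ on j as well, so their difference has two vertices unless i = j. *)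
Lemma facets_separate i j :
  shellable (pure_skeleton (independence_complex e) g) ->
  (forall F : {set T}, facet F -> (x i \in F) = (x j \in F)) -> i = j.
Proof.
move=> [s sh] ij.
have [||| F [H [v []]]] :=
  @shelling_crossing _ _ s (fun F => x i \in F) X Y sh.
- by rewrite facetsE; apply: facet_X.
- by rewrite facetsE; apply: facet_Y.
- by rewrite x_in_X (negPf (x_notin_Y i)).
rewrite !facetsE => fF fH /setP FH.
have := FH (x i); have := FH (x j); have := FH (y i); have := FH (y j).
rewrite !in_setD !in_set1 !facet_y // -(ij F fF) -(ij H fH).
case: (x i \in F); case: (x i \in H) => //=.
  by move=> _ _ /esym/eqP<- /esym/eqP/inj_x.
by move=> /esym/eqP<- /esym/eqP/inj_y.
Qed.

(** An arrow i -> j makes every facet through x_i contain x_j, so the number of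
    facets through x_i weakly increases along arrows; [facets_separate] makes
    the increase strict when i <> j. *)
Lemma shellable_order :
  shellable (pure_skeleton (independence_complex e) g) ->
  exists s : {perm 'I_g},
    forall i j : 'I_g, [set x (s i); y (s j)] \in edges e -> i <= j.
Proof.
move=> sh; pose through i := [set F | facet F & x i \in F].
have [s s_mono] := sorting_perm (fun i => #|through i|).
exists s => i j eij; rewrite leqNgt; apply/negP => ji.
have sub : through (s i) \subset through (s j).
  apply/subsetP => F; rewrite !inE => /andP[fF xF]; rewrite fF /=.
  have /andP[stF _] := fF.
  by have := stable_edge stF eij xF; rewrite facet_y // negbK.
have /eqP/setP eq_th : through (s i) == through (s j).
  by rewrite eqEcard sub s_mono.
have /perm_inj ij : s i = s j.
  by apply: facets_separate => // F fF; have := eq_th F; rewrite !inE fF.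
by rewrite ij ltnn in ji.
Qed.

(** Sorting the facets by their number of points x_i is a shelling: exchanging
    a suitable x_k for y_k lowers this number by one and so leads to an earlier
    facet. *)
Lemma order_shellable (s : {perm 'I_g}) :
  (forall i j : 'I_g, [set x (s i); y (s j)] \in edges e -> i <= j) ->
  shellable (pure_skeleton (independence_complex e) g).
Proof.
move=> s_ord; pose r (F H : {set T}) := #|F :&: X| <= #|H :&: X|.
have r_tr : transitive r by move=> A B C; apply: leq_trans.
have r_tot : total r by move=> A B; apply: leq_total.
pose fs := sort r (enum (facets (pure_skeleton (independence_complex e) g))).
have fs_uniq : uniq fs by rewrite sort_uniq enum_uniq.
have fsE : fs =i facet by move=> F; rewrite mem_sort mem_enum facetsE.
have r_nth i j : i < j < size fs -> r (nth set0 fs i) (nth set0 fs j).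
  case/andP=> ij js; apply: (sorted_ltn_nth r_tr) => //.
    exact: sort_sorted.
  by rewrite inE (ltn_trans ij).
exists fs; split=> // [F|i j ijs]; first by rewrite fsE facetsE.
have /andP[ij js] := ijs; have i_lt := ltn_trans ij js.
have rHF := r_nth _ _ ijs.
set H := nth set0 fs i in rHF *; set F := nth set0 fs j in rHF *.
have fF : facet F by rewrite -[facet F]fsE mem_nth.
have fH : facet H by rewrite -[facet H]fsE mem_nth.
have FH : F != H by rewrite nth_uniq // gtn_eqF.
pose P k := (x (s k) \in F) && (x (s k) \notin H).
(* F has at least as many points x_i as H and is determined by them. *)
have [k0 Pk0] : exists k, P k.
  apply/existsP; apply: contraR FH; rewrite negb_exists => /forallP sFH.
  have sub k : x k \in F -> x k \in H.
    have := sFH (s^-1%g k).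
    by rewrite /P permKV negb_and negbK -implybE => /implyP.
  have /eqP/setP eqX : F :&: X == H :&: X.
    rewrite eqEcard [_ <= _]rHF andbT; apply/subsetP => u /setIP[uF uX].
    by rewrite inE uX; case/imsetP: uX uF => k _ -> /sub->.
  apply/eqP/facet_inj => // k.
  by have := eqX (x k); rewrite !inE x_in_X !andbT.
case: (@arg_minnP _ k0 P (@nat_of_ord g) Pk0) => k /andP[kF kH] kmin.
pose F' := y (s k) |: (F :\ x (s k)).
have fF' : facet F'.
  apply: exchange_stable => // a; rewrite -(permKV s a).
  set b := (s^-1%g a) => bF ebk; congr (s _).
  apply/val_inj/eqP; rewrite eqn_leq s_ord //= kmin // /P bF /=.
  (* The index set of H is closed under -> and omits s k. *)
  apply: contra kH => bH; have /andP[stH _] := fH.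
  by have := stable_edge stH ebk bH; rewrite facet_y // negbK.
have F'fs : F' \in fs by rewrite fsE.
have F'X : #|F' :&: X| < #|F :&: X|.
  apply/proper_card/properP; split; last first.
    exists (x (s k)); first by rewrite inE kF x_in_X.
    by rewrite !inE eqxx (negPf (x_neq_y _ _)).
  apply/subsetP => u /setIP[uF' uX]; rewrite inE uX andbT.
  case/imsetP: uX uF' => a _ ->.
  by rewrite !inE (negPf (x_neq_y _ _)) => /andP[].
exists (x (s k)), (index F' fs); split.
- by rewrite inE kH.
- rewrite ltnNge leq_eqVlt; apply/negP => /orP[/eqP jF'|jF'].
    by move: F'X; rewrite /F jF' nth_index // ltnn.
  have := r_nth j (index F' fs); rewrite jF' index_mem F'fs nth_index //.
  by rewrite /r leqNgt F'X => /(_ isT).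
- rewrite nth_index //; apply/setP => u; rewrite !inE.
  have [->|ux] := eqVneq u (x (s k)).
    by rewrite (negPf (x_neq_y _ _)) kF.
  by rewrite /=; case: (u \in F); rewrite ?orbT ?andbF.
Qed.

End Matching.

Theorem theorem4p3 (T : finType) (e : rel T)
    (sym_e : symmetric e) (irr_e : irreflexive e)
    (g : nat) (x y : 'I_g -> T)
    (inj_x : injective x) (inj_y : injective y)
    (bip : bipartition e [set x i | i : 'I_g] [set y i | i : 'I_g])
    (pm : perfect_matching e [set [set x i; y i] | i : 'I_g]) :
  pure_shellable (pure_skeleton (independence_complex e) g) <->
  exists s : {perm 'I_g},
    forall i j : 'I_g, [set x (s i); y (s j)] \in edges e -> i <= j.
Proof.
have xy_edge i : [set x i; y i] \in edges e.
  by case: pm => /subsetP sub _; apply/sub/imset_f.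
split=> [[_ sh]|[s s_ord]]; first exact: shellable_order.
split; last exact: order_shellable s_ord.
move=> F H; rewrite !facets_pure_skeleton !inE.
by move=> /andP[_ /eqP->] /andP[_ /eqP->].
Qed.
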